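(* Let $(x_1,x_2,x_3)\in\mathbb{C}^3$. Then $(x_1,x_2,x_3,0)\in\mathbb{F}$ if and only if $(0,x_1,x_2,x_3)\in\mathbb{H}$, which in turn holds if and only if $(x_1,x_2,x_3)\in\mathbb{E}$.
   Context: $\mathbb{D}=\{z\in\mathbb{C}:|z|<1\}$; $M_2(\mathbb{C})$ is the space of $2\times 2$ complex matrices and $\|A\|$ is the operator norm of $A$. The domain $\mathbb{F}$ is \[ \mathbb{F}=\{(a_{11},a_{22},\det(A),a_{12}+a_{21})\in\mathbb{C}^4 : A=(a_{ij})_{i,j=1}^2\in M_2(\mathbb{C}),\ \|A\|<1\}. \] The tetrablock is $\mathbb{E}=\{(x_1,x_2,x_3)\in\mathbb{C}^3 : 1-x_1z_1-x_2z_2+x_3z_1z_2\neq 0 \text{ for all } |z_1|\le 1,\ |z_2|\le 1\}$. The hexablock is \[ \mathbb{H}=\left\{(a,x_1,x_2,x_3)\in\mathbb{C}\times\mathbb{E} : \sup_{z_1,z_2\in\mathbb{D}}\left|\frac{a\sqrt{(1-|z_1|^2)(1-|z_2|^2)}}{1-x_1z_1-x_2z_2+x_3z_1z_2}\right|<1\right\}. \] *)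

(* Defs.v *)
From mathcomp Require Import all_boot all_order all_algebra.
From mathcomp Require Import boolp classical_sets reals constructive_ereal ereal.
From mathcomp Require Import complex.

Set Implicit Arguments.
Unset Strict Implicit.
Unset Printing Implicit Defensive.

Import Order.TTheory GRing.Theory Num.Theory.
Local Open Scope classical_set_scope.
Local Open Scope ring_scope.
Local Open Scope complex_scope.

(* The modulus of z : R[i] is taken as [normc z], which lives in R, rather than
   as [`|z|], which lives in R[i]: the suprema below are those of R and \bar R. *)
Notation cmod := ComplexField.Normc.normc.

Definition disc (R : realType) : set R[i] := [set z | cmod z < 1].
Arguments disc R : clear implicits.

(* Euclidean norm (the norm carried by matrix types is the max norm). *)
Definition l2norm (R : realType) (n : nat) (v : 'cV[R[i]]_n) : R :=
  Num.sqrt (\sum_(i < n) cmod (v i ord0) ^+ 2).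

(* [sup] is 0 on unbounded sets, but this set is always bounded and nonempty. *)
Definition opnorm (R : realType) (n : nat) (A : 'M[R[i]]_n) : R :=
  sup [set l2norm (A *m v) | v in [set v : 'cV[R[i]]_n | l2norm v <= 1]].

Definition domainF (R : realType) : set (R[i] * R[i] * R[i] * R[i]) :=
  [set (A 0 0, A 1 1, \det A, A 0 1 + A 1 0) |
    A in [set A : 'M[R[i]]_2 | opnorm A < 1]].
Arguments domainF R : clear implicits.

Definition tetra_poly (R : realType) (x1 x2 x3 z1 z2 : R[i]) : R[i] :=
  1 - x1 * z1 - x2 * z2 + x3 * z1 * z2.

Definition tetrablock (R : realType) : set (R[i] * R[i] * R[i]) :=
  [set x | let: (x1, x2, x3) := x in
    forall z1 z2 : R[i], cmod z1 <= 1 -> cmod z2 <= 1 ->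
      tetra_poly x1 x2 x3 z1 z2 != 0].
Arguments tetrablock R : clear implicits.

Definition hexa_fun (R : realType) (a x1 x2 x3 z1 z2 : R[i]) : R[i] :=
  a * (Num.sqrt ((1 - cmod z1 ^+ 2) * (1 - cmod z2 ^+ 2)))%:C
    / tetra_poly x1 x2 x3 z1 z2.

(* The supremum is taken in \bar R, so that it is +oo when unbounded. *)
Definition hexablock (R : realType) : set (R[i] * R[i] * R[i] * R[i]) :=
  [set p | let: (a, x1, x2, x3) := p in
    tetrablock R (x1, x2, x3) /\
    (ereal_sup [set (cmod (hexa_fun a x1 x2 x3 z1 z2))%:E |
                 z1 in disc R & z2 in disc R] < 1)%E].
Arguments hexablock R : clear implicits.

(* Main.v *)
(* [tetra_poly x1 x2 x3 z1 z2] is det(1 - A diag(z1, z2)) for any matrix A with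
   diagonal (x1, x2) and determinant x3, so it cannot vanish when A is a strict
   contraction.  Conversely take A = [[x1, w], [-w, x2]] with w^2 = x3 - x1 x2.
   For |z| <= 1 the points of the tetrablock satisfy |x2 - x3 z| < |1 - x1 z|;
   optimizing over |z| = 1 and rewriting the result gives
   0 < 1 - |x1|^2 - |x2|^2 + |x3|^2 - 2 |x1 x2 - x3| = det(1 - A^* A) =: d, and
   then |A v|^2 <= (1 - d/2) |v|^2 for every v.  At a = 0 the supremum in the
   definition of the hexablock is 0, so that condition is void. *)
Require Import Defs.
From mathcomp Require Import all_boot all_order all_algebra.
From mathcomp Require Import boolp classical_sets reals constructive_ereal ereal.
From mathcomp Require Import complex.
From mathcomp Require Import ring lra.

Import ComplexField.Normc.
Import Order.TTheory GRing.Theory Num.Theory.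
Local Open Scope ring_scope.

(** * Modulus, Euclidean norm and operator norm *)

Lemma cmodE (R : realType) (z : R[i]) :
  cmod z = Num.sqrt (complex.Re z ^+ 2 + complex.Im z ^+ 2).
Proof. by case: z. Qed.

Lemma sqr_cmod (R : realType) (z : R[i]) :
  cmod z ^+ 2 = complex.Re z ^+ 2 + complex.Im z ^+ 2.
Proof. by rewrite cmodE sqr_sqrtr// addr_ge0 ?sqr_ge0. Qed.

Lemma cmod_ge0 (R : realType) (z : R[i]) : 0 <= cmod z.
Proof. by rewrite cmodE sqrtr_ge0. Qed.

Lemma cmod_real (R : realType) (a : R) : cmod (a%:C)%C = `|a|.
Proof. by rewrite cmodE /= expr0n addr0 sqrtr_sqr. Qed.

Lemma cmod_conj (R : realType) (z : R[i]) : cmod (z^*)%C = cmod z.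
Proof. by case: z => a b; rewrite !cmodE /= sqrrN. Qed.

Lemma ler_cmod_sum (R : realType) (I : Type) (r : seq I) (P : pred I)
    (F : I -> R[i]) :
  cmod (\sum_(i <- r | P i) F i) <= \sum_(i <- r | P i) cmod (F i).
Proof.
elim/big_ind2: _ => //; first by rewrite normc0.
move=> x a y b xa yb; exact: le_trans (le_normcD _ _) (lerD xa yb).
Qed.

Lemma l2norm_ge0 (R : realType) (n : nat) (v : 'cV[R[i]]_n) : 0 <= l2norm v.
Proof. exact: sqrtr_ge0. Qed.

Lemma sqr_l2norm (R : realType) (n : nat) (v : 'cV[R[i]]_n) :
  l2norm v ^+ 2 = \sum_(i < n) cmod (v i ord0) ^+ 2.
Proof. by rewrite sqr_sqrtr// sumr_ge0// => i _; rewrite sqr_ge0. Qed.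

Lemma l2norm_eq0 (R : realType) (n : nat) (v : 'cV[R[i]]_n) :
  l2norm v = 0 -> v = 0.
Proof.
move=> v0; apply/matrixP => i j; rewrite (ord1 j) mxE.
have /eqP := sqr_l2norm R n v; rewrite v0 expr0n eq_sym psumr_eq0; last first.
  by move=> k _; rewrite sqr_ge0.
move=> /allP /(_ i); rewrite mem_index_enum => /(_ isT).
by rewrite sqrf_eq0 => /eqP /eq0_normc.
Qed.

Lemma l2normZ (R : realType) (n : nat) (c : R[i]) (v : 'cV[R[i]]_n) :
  l2norm (c *: v) = cmod c * l2norm v.
Proof.
apply/eqP; rewrite -(@eqrXn2 _ 2) ?mulr_ge0 ?l2norm_ge0 ?cmod_ge0//.
rewrite exprMn !sqr_l2norm mulr_sumr; apply/eqP/eq_bigr => i _.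
by rewrite mxE normcM exprMn.
Qed.

Lemma cmod_le_l2norm (R : realType) (n : nat) (v : 'cV[R[i]]_n) (i : 'I_n) :
  cmod (v i ord0) <= l2norm v.
Proof.
rewrite -(@ler_pXn2r _ 2) ?nnegrE ?cmod_ge0 ?l2norm_ge0// sqr_l2norm.
by rewrite (bigD1 i)//= lerDl sumr_ge0// => j _; rewrite sqr_ge0.
Qed.

Lemma l2norm_mulmx_le_opnorm (R : realType) (n : nat) (A : 'M[R[i]]_n)
    (v : 'cV[R[i]]_n) :
  l2norm v <= 1 -> l2norm (A *m v) <= opnorm A.
Proof.
move=> v1; apply: ub_le_sup; last by exists v.
(* An upper bound keeps [sup] from its default value: on the unit ball each entry of [A *m u] is at
   most the sum of the moduli in its row of [A]. *)
exists (Num.sqrt (\sum_i (\sum_j cmod (A i j)) ^+ 2)) => _ [u u1 <-].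
rewrite ler_sqrt ?sumr_ge0//; last by move=> i _; rewrite sqr_ge0.
apply: ler_sum => i _.
rewrite ler_pXn2r ?nnegrE ?cmod_ge0 ?sumr_ge0// => [|j _]; last first.
  exact: cmod_ge0.
rewrite mxE (le_trans (ler_cmod_sum _ _ _ _ _))// ler_sum// => j _.
rewrite normcM ler_piMr ?cmod_ge0//.
exact: le_trans (cmod_le_l2norm _ _ _ _) u1.
Qed.

(** If [v] were nonzero, dividing [u] by the norm of [v] would give a vector of the unit ball whose
    image has norm 1. *)
Lemma opnorm_lt1_contract (R : realType) (n : nat) (A : 'M[R[i]]_n)
    (u v : 'cV[R[i]]_n) :
  opnorm A < 1 -> l2norm u <= l2norm v -> A *m u = v -> v = 0.
Proof.
move=> A1 uv Auv; apply: l2norm_eq0; apply/eqP/negPn/negP => v0.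
have vp : 0 < l2norm v by rewrite lt_neqAle eq_sym v0 l2norm_ge0.
pose c : R[i] := ((l2norm v)^-1)%:C%C.
have cE : cmod c = (l2norm v)^-1.
  by rewrite cmod_real ger0_norm// invr_ge0 ltW.
have cu : l2norm (c *: u) <= 1 by rewrite l2normZ cE mulrC ler_pdivrMr// mul1r.
have := le_lt_trans (l2norm_mulmx_le_opnorm _ _ A _ cu) A1.
by rewrite -scalemxAr Auv l2normZ cE mulVf// ltxx.
Qed.

(** With D the diagonal matrix, a kernel vector [w] satisfies [w = A (D w)] with [D w] no longer
    than [w], so it is 0. The transposition is there because [det0P] speaks of left kernels. *)
Lemma opnorm_lt1_det_neq0 (R : realType) (n : nat) (A : 'M[R[i]]_n)
    (d : 'rV[R[i]]_n) :
  opnorm A < 1 -> (forall i, cmod (d ord0 i) <= 1) ->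
  \det (1%:M - A *m diag_mx d) != 0.
Proof.
move=> A1 d1; apply/negP; rewrite -det_tr => /det0P[w w0 wM].
have {}wM : A *m (diag_mx d *m w^T) = w^T.
  apply/esym/eqP; rewrite mulmxA -subr_eq0 -{1}[w^T]mul1mx -mulmxBl.
  by rewrite -[X in X *m _]trmxK -trmx_mul wM trmx0.
move: w0; rewrite -trmx_eq0 (opnorm_lt1_contract _ _ _ _ _ A1 _ wM) ?eqxx//.
rewrite -(@ler_pXn2r _ 2) ?nnegrE ?l2norm_ge0// !sqr_l2norm ler_sum// => i _.
rewrite mul_diag_mx !mxE ler_pXn2r ?nnegrE ?cmod_ge0// normcM.
by rewrite ler_piMl ?cmod_ge0.
Qed.

Lemma opnorm_le (R : realType) (n : nat) (A : 'M[R[i]]_n) (c : R) :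
  0 <= c -> (forall v, l2norm (A *m v) ^+ 2 <= c * l2norm v ^+ 2) ->
  opnorm A <= Num.sqrt c.
Proof.
move=> c0 Ac; apply: ge_sup.
  exists (l2norm (A *m (0 : 'cV_n))), 0 => //=.
  by rewrite -(scale0r (0 : 'cV_n)) l2normZ normc0 mul0r.
move=> _ [v /= v1 <-].
rewrite -(@ler_pXn2r _ 2) ?nnegrE ?l2norm_ge0 ?sqrtr_ge0// (sqr_sqrtr c0).
by rewrite (le_trans (Ac v))// ler_piMr// expr_le1// l2norm_ge0.
Qed.

Lemma det_mx22 (K : comNzRingType) (A : 'M[K]_2) :
  \det A = A 0 0 * A 1 1 - A 0 1 * A 1 0.
Proof.
rewrite (expand_det_row _ 0) !big_ord_recl big_ord0 addr0 /cofactor !det_mx11.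
rewrite !mxE /= expr0 mul1r expr1 mulN1r mulrN.
by congr (_ * A _ _ - A _ _ * A _ _); apply/val_inj.
Qed.

Lemma domainF_tetrablock (R : realType) (x1 x2 x3 : R[i]) (t : R[i]) :
  domainF R (x1, x2, x3, t) -> tetrablock R (x1, x2, x3).
Proof.
move=> [A /= A1 [<- <- <- _]] z1 z2 z1_1 z2_1.
pose d : 'rV[R[i]]_2 := \row_j (if j == 0 then z1 else z2).
have d1 i : cmod (d ord0 i) <= 1 by rewrite mxE; case: ifP.
have := opnorm_lt1_det_neq0 _ _ _ _ A1 d1; rewrite !det_mx22.
rewrite mul_mx_diag !mxE /=; apply: contra_neq; rewrite /tetra_poly => tp0.
by rewrite -[RHS]tp0; ring.
Qed.

(** * Inequalities on the tetrablock *)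

Lemma tetrablock_sym (R : realType) (x1 x2 x3 : R[i]) :
  tetrablock R (x1, x2, x3) -> tetrablock R (x2, x1, x3).
Proof.
move=> xE z1 z2 z1_1 z2_1; have := xE z2 z1 z2_1 z1_1.
by rewrite /tetra_poly; congr (_ != _); ring.
Qed.

(** Otherwise [z2 = (1 - x1 z) / (x2 - x3 z)] lies in the closed disc and [tetra_poly] vanishes at
    [(z, z2)]; if the denominator is 0, so is the numerator, and [z2 = 0] serves. *)
Lemma tetrablock_slice (R : realType) (x1 x2 x3 z : R[i]) :
  tetrablock R (x1, x2, x3) -> cmod z <= 1 ->
  cmod (x2 - x3 * z) < cmod (1 - x1 * z).
Proof.
move=> xE z1; rewrite ltNge; apply/negP => le_xz.
have [y0|y0] := eqVneq (x2 - x3 * z) 0.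
  move: le_xz; rewrite y0 normc0 => le0.
  have /eq0_normc e0 : cmod (1 - x1 * z) = 0.
    by apply/le_anti; rewrite le0 cmod_ge0.
  have := xE z 0 z1; rewrite normc0 ler01 => /(_ isT).
  by rewrite /tetra_poly !mulr0 subr0 addr0 e0 eqxx.
have yp : 0 < cmod (x2 - x3 * z).
  rewrite lt_neqAle cmod_ge0 andbT eq_sym.
  by apply: contraNneq y0 => /eq0_normc ->.
have := xE z ((1 - x1 * z) / (x2 - x3 * z)) z1.
rewrite normcM normcV ler_pdivrMr// mul1r => /(_ le_xz) /negP; apply; apply/eqP.
by rewrite /tetra_poly; field.
Qed.

Lemma tetrablock_cmod_lt1 (R : realType) (x1 x2 x3 : R[i]) :
  tetrablock R (x1, x2, x3) -> cmod x1 < 1.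
Proof.
move=> xE; rewrite ltNge; apply/negP => x1_ge1.
have x1_neq0 : x1 != 0.
  by apply: contraTneq x1_ge1 => ->; rewrite normc0 -ltNge ltr01.
(* At [z = 1 / x1] the right-hand side of the slice inequality is 0. *)
have := @tetrablock_slice R _ _ _ x1^-1 xE.
rewrite normcV invf_le1 ?(lt_le_trans ltr01)// => /(_ x1_ge1).
by rewrite divff// subrr normc0 ltNge cmod_ge0.
Qed.

(* Squaring the slice inequality at |z| = 1 gives
   [2 Re ((x1 - x2^* x3) z) < 1 + |x1|^2 - |x2|^2 - |x3|^2]; then z is chosen to
   rotate [x1 - x2^* x3] onto the positive axis. *)
Lemma tetrablock_cmod_sub (R : realType) (x1 x2 x3 : R[i]) :
  tetrablock R (x1, x2, x3) ->
  2 * cmod (x1 - x2^*%C * x3) <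
  1 + cmod x1 ^+ 2 - cmod x2 ^+ 2 - cmod x3 ^+ 2.
Proof.
move=> xE; set k := x1 - _.
have [z z1 kz] : exists2 z, cmod z = 1 & k * z = ((cmod k)%:C)%C.
  have [k0|k0] := eqVneq (cmod k) 0.
    exists 1; first by rewrite normc1.
    by rewrite k0 (eq0_normc k0) mul0r.
  exists (k^*%C * ((cmod k)^-1)%:C%C).
    by rewrite normcM cmod_conj cmod_real ger0_norm ?invr_ge0 ?cmod_ge0// divff.
  have kk : k * k^*%C = ((cmod k ^+ 2)%:C)%C.
    rewrite sqr_cmod; case: (k) => a b; apply/eqP.
    by rewrite eq_complex /=; apply/andP; split; apply/eqP; ring.
  by rewrite mulrA kk -rmorphM /= expr2 mulfK.
have := @tetrablock_slice R _ _ _ z xE; rewrite z1 lexx => /(_ isT) xz.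
have {xz} : cmod (x2 - x3 * z) ^+ 2 < cmod (1 - x1 * z) ^+ 2.
  by rewrite ltr_pXn2r ?nnegrE ?cmod_ge0.
have z1' : cmod z ^+ 2 = 1 by rewrite z1 expr1n.
have -> : cmod k = complex.Re (k * z) by rewrite kz.
move: z1'; rewrite /k !sqr_cmod; clear.
case: x1 x2 x3 z => [a b] [c d] [e f] [g h] /= gh H.
rewrite -subr_gt0 in H; rewrite -subr_gt0; apply: (lt_le_trans H).
rewrite le_eqVlt; apply/orP; left; apply/eqP.
(* Subtracting a multiple of [|z|^2 - 1 = 0] replaces [|z|^2] by 1, which [ring] cannot do. *)
have E : forall p q : R, p - q =
  (p - q) - ((a ^+ 2 + b ^+ 2) - (e ^+ 2 + f ^+ 2)) * (g ^+ 2 + h ^+ 2 - 1)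
   by move=> p q; rewrite gh subrr mulr0 subr0.
by rewrite [LHS]E; ring.
Qed.

Lemma tetrablock_cmod_det (R : realType) (x1 x2 x3 : R[i]) :
  tetrablock R (x1, x2, x3) ->
  2 * cmod (x1 * x2 - x3) <
  1 - cmod x1 ^+ 2 - cmod x2 ^+ 2 + cmod x3 ^+ 2 /\ cmod x3 < 1.
Proof.
move=> xE; have yE := tetrablock_sym _ _ _ _ xE.
have p1 := tetrablock_cmod_lt1 _ _ _ _ xE.
have q1 := tetrablock_cmod_lt1 _ _ _ _ yE.
have H1 := tetrablock_cmod_sub _ _ _ _ xE.
have H2 := tetrablock_cmod_sub _ _ _ _ yE.
have T : cmod x1 * cmod x2 <= cmod (x1 * x2 - x3) + cmod x3.
  by rewrite -normcM -{1}(subrK x3 (x1 * x2)) le_normcD.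
(* This identity carries the bound on [x1 - conj(x2) x3] over to [x1 x2 - x3], up to the sign of
   [1 - p^2 - q^2 + s^2]. *)
have I : (1 + cmod x1 ^+ 2 - cmod x2 ^+ 2 - cmod x3 ^+ 2) ^+ 2
      - 4 * cmod (x1 - x2^*%C * x3) ^+ 2
    = (1 - cmod x1 ^+ 2 - cmod x2 ^+ 2 + cmod x3 ^+ 2) ^+ 2
      - 4 * cmod (x1 * x2 - x3) ^+ 2.
  rewrite !sqr_cmod; case: (x1) (x2) (x3) => [a b] [c d] [e f] /=; ring.
move: H1 H2 T I.
move: (cmod_ge0 _ x1) (cmod_ge0 _ x2) (cmod_ge0 _ x3)
  (cmod_ge0 _ (x1 * x2 - x3)) (cmod_ge0 _ (x1 - x2^*%C * x3))
  (cmod_ge0 _ (x2 - x1^*%C * x3)) p1 q1.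
move: (cmod (x1 * x2 - x3)) (cmod (x1 - x2^*%C * x3)) (cmod (x2 - x1^*%C * x3)).
move: (cmod x1) (cmod x2) (cmod x3) => p q s b k l.
move=> p0 q0 s0 b0 k0 l0 p1 q1 H1 H2 T I.
(* Adding [H1] and [H2] gives [s^2 < 1]. *)
have s1 : s < 1 by nra.
split => //.
have B : 4 * b ^+ 2 < (1 - p ^+ 2 - q ^+ 2 + s ^+ 2) ^+ 2 by nra.
have [D0|D0] := ltP 0 (1 - p ^+ 2 - q ^+ 2 + s ^+ 2); first by nra.
(* The nonpositive case is absurd: [T] and [bD] force [(1 - s)^2 < (p - q)^2], while [p, q] both lie
   between [s] and 1. *)
have sp : s < p by nra.
have sq : s < q by nra.
have bD : 2 * b < p ^+ 2 + q ^+ 2 - 1 - s ^+ 2 by nra.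
have : 0 < (1 - s - (p - q)) * (1 - s + (p - q)) by apply: mulr_gt0; lra.
have -> : (1 - s - (p - q)) * (1 - s + (p - q)) =
  1 - 2 * s + s ^+ 2 - (p ^+ 2 + q ^+ 2) + 2 * (p * q) by ring.
lra.
Qed.

(** * A strict contraction for each point of the tetrablock *)

Lemma hermitian_form_ge0 (R : realType) (s t : R) (m y z : R[i]) :
  0 < s -> cmod m ^+ 2 <= s * t ->
  2 * complex.Re (m * y * z^*%C) <= s * cmod y ^+ 2 + t * cmod z ^+ 2.
Proof.
move=> s0 mst; rewrite -subr_ge0 -(pmulr_rge0 _ s0).
(* Completing the square, after multiplication by [s > 0]. *)
have -> : s * (s * cmod y ^+ 2 + t * cmod z ^+ 2
      - 2 * complex.Re (m * y * z^*%C)) =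
    cmod (s%:C%C * y - m^*%C * z) ^+ 2 + (s * t - cmod m ^+ 2) * cmod z ^+ 2.
  by rewrite !sqr_cmod; case: (m) (y) (z) => [? ?] [? ?] [? ?] /=; ring.
by rewrite addr_ge0 ?sqr_ge0// mulr_ge0 ?subr_ge0 ?sqr_ge0.
Qed.

Lemma tetrablock_domainF (R : realType) (x1 x2 x3 : R[i]) :
  tetrablock R (x1, x2, x3) -> domainF R (x1, x2, x3, 0).
Proof.
move=> xE; have [xdet x3_1] := tetrablock_cmod_det _ _ _ _ xE.
set w := sqrtc (x3 - x1 * x2).
have w2 : w * w = x3 - x1 * x2 by rewrite -expr2 sqr_sqrtc.
have x3E : x3 = x1 * x2 + w * w by rewrite w2 addrC subrK.
pose A : 'M[R[i]]_2 := \matrix_(i, j)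
  if i == 0 then if j == 0 then x1 else w else if j == 0 then - w else x2.
exists A; last first.
  rewrite det_mx22 !mxE /= subrr; congr (_, _, _, _); rewrite x3E; ring.
have wb : cmod w ^+ 2 = cmod (x1 * x2 - x3).
  by rewrite -[RHS]normcN opprB -w2 normcM expr2.
pose b := cmod w ^+ 2.
pose d := 1 - cmod x1 ^+ 2 - cmod x2 ^+ 2 + cmod x3 ^+ 2 - 2 * b.
have d0 : 0 < d by rewrite subr_gt0 /b wb.
have dE : d = (1 - cmod x1 ^+ 2 - b) * (1 - cmod x2 ^+ 2 - b)
    - cmod (x1 * w^*%C - w * x2^*%C) ^+ 2.
  rewrite /d /b x3E !sqr_cmod.
  by case: (x1) (x2) (w) => [? ?] [? ?] [? ?] /=; ring.
(* [u] and [v] are the diagonal entries of [1 - A^* A]; [m] is, up to sign, an off-diagonal one. *)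
pose u := 1 - cmod x1 ^+ 2 - b; pose v := 1 - cmod x2 ^+ 2 - b.
pose m := x1 * w^*%C - w * x2^*%C.
have [u0 v0 u1 v1] : [/\ 0 < u, 0 < v, u <= 1 & v <= 1].
  have p0 := sqr_ge0 (cmod x1); have q0 := sqr_ge0 (cmod x2).
  have b0 : 0 <= b by rewrite sqr_ge0.
  have r1 : cmod x3 ^+ 2 < 1 by rewrite expr_lt1// cmod_ge0.
  (* Here [u + v = d + 1 - |x3|^2]; a positive sum and a positive product make both entries
     positive. *)
  have uvD : 0 < u + v by move: d0; rewrite /u /v /d; lra.
  have uvM : 0 < u * v.
    by rewrite -(subrK (cmod m ^+ 2) (u * v)) -dE ltr_wpDr// sqr_ge0.
  by split; rewrite /u /v in uvD uvM *; nra.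
have m0 : 0 <= cmod m ^+ 2 by rewrite sqr_ge0.
have {}dE : d = u * v - cmod m ^+ 2 by [].
(* The shift [d / 2] keeps the form nonnegative: [d <= u v] is at most [u] and [v], and [u + v <= 2]
   gives [(u - d/2) (v - d/2) >= u v - d = |m|^2]. *)
have ud0 : 0 < u - d / 2 by nra.
have vd0 : 0 < v - d / 2 by nra.
have muv : cmod m ^+ 2 <= (u - d / 2) * (v - d / 2) by nra.
have c0 : 0 <= 1 - d / 2 by lra.
apply: (le_lt_trans (opnorm_le _ _ _ _ c0 _)); last first.
  by rewrite -[X in _ < X]sqrtr1 ltr_sqrt// ltrBlDr ltrDl divr_gt0.
move=> y; rewrite !sqr_l2norm !big_ord_recl !big_ord0 !mxE !big_ord_recl.
rewrite !big_ord0 !mxE /= !addr0.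
(* [(1 - d/2) |y|^2 - |A y|^2] is exactly the shifted Hermitian form at [y]. *)
have := hermitian_form_ge0 _ _ _ _ (y ord0 ord0)
  (y (lift ord0 ord0) ord0) ud0 muv.
move: (y ord0 ord0) (y (lift ord0 ord0) ord0) => y1 y2.
rewrite -subr_ge0 -[X in _ -> is_true X]subr_ge0.
congr (0 <= _); rewrite /m /u /v /b !sqr_cmod.
by case: (x1) (x2) (w) y1 y2 => [? ?] [? ?] [? ?] [? ?] [? ?] /=; ring.
Qed.

Theorem proposition2p13 (R : realType) (x1 x2 x3 : R[i]) :
  (domainF R (x1, x2, x3, 0) <-> hexablock R (0, x1, x2, x3)) /\
  (hexablock R (0, x1, x2, x3) <-> tetrablock R (x1, x2, x3)).
Proof.
have HE : hexablock R (0, x1, x2, x3) <-> tetrablock R (x1, x2, x3).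
  split=> [[]//|xE]; split=> //.
  apply: (@le_lt_trans _ _ 0%E); last by rewrite lte01.
  apply: ge_ereal_sup => _ [z1 _ [z2 _ <-]].
  by rewrite /hexa_fun !mul0r normc0.
split=> //; split=> [/domainF_tetrablock /HE //|/HE].
exact: tetrablock_domainF.
Qed.
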